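(* Let $\mathcal{M}_\Sigma$ be a trace monoid, let $S,T\subseteq\Sigma$ and $p\in(0,p_S)$. Consider the following recursive randomized procedure $\mathrm{A}_1(p,S,T)$: if $S\cap T=\emptyset$, return $\mathbf{e}$; otherwise choose $a_1\in S\cap T$, set $r=1-\mu_S(p)/\mu_{S\setminus\{a_1\}}(p)$, draw an integer $K$ with $\mathbb{P}(K=k)=(1-r)r^k$ ($k\geqslant0$), set $\xi=\mathbf{e}$, then for $i=0,\dots,K-1$ compute $v_i=\mathrm{A}_1(p,S\setminus\{a_1\},\mathscr{L}(a_1))$ (independently) and set $\xi\gets\xi\cdot v_i\cdot a_1$; finally compute $v_K=\mathrm{A}_1(p,S\setminus\{a_1\},T)$, set $\xi\gets\xi\cdot v_K$ and return $\xi$. Then the output $\xi\in\mathcal{M}_S$ has law $D^{p}_{S,T}$, i.e. $B_{S,p}(\,\cdot\mid\max(\xi)\subseteq T)$. Moreover, assume all real numbers $\mu_X(p)$ ($X\subseteq\Sigma$) are precomputed; that choosing an element of the intersection of two subsets of $\Sigma$, a function call, a variable assignment and a multiplication in $\mathcal{M}_\Sigma$ each take a constant number of steps; and that drawing a random integer with value $X$ takes at most a constant times $X+1$ steps. Then there is a constant $C$ (depending only on these cost constants) such that every execution of $\mathrm{A}_1(p,S,T)$ outputting $\xi$ takes at most $C(|\Sigma|+1)(|\xi|+1)$ steps, i.e. $\mathcal{O}(|\Sigma|(|\xi|+1))$ steps.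
   Context: Let $\Sigma$ be a finite alphabet and $\mathcal{R}$ a reflexive and symmetric binary relation on $\Sigma$. The trace monoid $\mathcal{M}_\Sigma$ is the quotient of $\Sigma^*$ by the congruence generated by $ab=ba$ for all $(a,b)\notin\mathcal{R}$; unit $\mathbf{e}$. For $\Sigma'\subseteq\Sigma$, $\mathcal{M}_{\Sigma'}$ is the submonoid generated by $\Sigma'$. $|x|$ is the length of $x$; $\max(x)$ is the set of letters $a$ with $x=y\cdot a$ for some trace $y$. $\mathscr{L}(a)=\{b\in\Sigma:(a,b)\in\mathcal{R}\}$. For $S\subseteq\Sigma$, a clique of $S$ is a subset of $S$ of pairwise non-$\mathcal{R}$-related letters (empty set included); $\mu_S(X)=\sum_{\gamma\text{ clique of }S}(-1)^{|\gamma|}X^{|\gamma|}$, $\mu_\emptyset=1$. For $S\neq\emptyset$, $p_S$ is the unique root of smallest modulus of $\mu_S$ (real, $0<p_S\leqslant1$); $p_\emptyset=+\infty$; $p_S\leqslant p_{S'}$ when $S'\subseteq S$. For $p\in(0,p_S)$, $\sum_{x\in\mathcal{M}_S}p^{|x|}=1/\mu_S(p)<\infty$ and $B_{S,p}$ is the probability distribution on $\mathcal{M}_S$ with $B_{S,p}(\{x\})=\mu_S(p)p^{|x|}$. $D^{p}_{S,T}=B_{S,p}(\,\cdot\mid\max(\xi)\subseteq T)$. *)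

(* Defs.v *)
From HB Require Import structures.
From mathcomp Require Import all_boot all_order all_algebra.
From mathcomp Require Import all_classical all_reals all_analysis.
From mathcomp Require Import complex.

Set Implicit Arguments.
Unset Strict Implicit.
Unset Printing Implicit Defensive.

Import Order.TTheory GRing.Theory Num.Theory.
Local Open Scope classical_set_scope.
Local Open Scope ring_scope.

Section TraceMonoid.
Variable Sig : finType.
(* The relation R on Sigma; (a,b) \notin R means a and b commute. *)
Variable rel : rel Sig.

Inductive tr_eq : seq Sig -> seq Sig -> Prop :=
| tr_refl w : tr_eq w w
| tr_sym u v : tr_eq u v -> tr_eq v u
| tr_trans u v w : tr_eq u v -> tr_eq v w -> tr_eq u w
| tr_swap a b : ~~ rel a b -> tr_eq [:: a; b] [:: b; a]
| tr_cat u u' v v' : tr_eq u u' -> tr_eq v v' -> tr_eq (u ++ v) (u' ++ v').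

(* A trace is represented by its congruence class, a set of words. *)
Definition tclass (w : seq Sig) : set (seq Sig) := [set w' | tr_eq w w'].

Definition MS (S : {set Sig}) : set (set (seq Sig)) :=
  [set x | exists w, all (fun a => a \in S) w /\ x = tclass w].

(* |x| : length of a trace (all representatives have the same length). *)
Definition tlen (x : set (seq Sig)) : nat := size (xget [::] x).

Definition tmax (x : set (seq Sig)) : set Sig :=
  [set a | exists v, x = tclass (rcons v a)].

Definition Lset (a : Sig) : {set Sig} := [set b | rel a b].

Definition clique (g : {set Sig}) : bool :=
  [forall a in g, forall b in g, ~~ rel a b || (a == b)].

Section Reals.
Variable R : realType.

Definition muP (S : {set Sig}) : {poly R} :=
  \sum_(g : {set Sig} | (g \subset S) && clique g)
     ((-1) ^+ #|g|) *: 'X^#|g|.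

Definition mu (S : {set Sig}) (x : R) : R := (muP S).[x].

(* "p \in (0, p_S)": p_S is the root of smallest modulus of mu_S
   (p_S = +oo if S is empty, i.e. mu_S = 1 has no roots);
   p < p_S means p is smaller than the modulus of every complex root. *)
Definition in_0_pS (S : {set Sig}) (p : R) : Prop :=
  0 < p /\
  forall z : R[i], root (map_poly (fun c : R => c%:C%C) (muP S)) z ->
    (p%:C%C < `|z|)%R.

Local Open Scope ereal_scope.
Definition Bsp (S : {set Sig}) (p : R) (A : set (set (seq Sig))) : \bar R :=
  \esum_(x in A `&` MS S) (mu S p * p ^+ tlen x)%:E.

Definition maxT (T : {set Sig}) : set (set (seq Sig)) :=
  [set x | tmax x `<=` [set a | a \in T]].

Definition Dsp (S T : {set Sig}) (p : R) (x : set (seq Sig)) : R :=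
  (fine (Bsp S p ([set x] `&` maxT T)) / fine (Bsp S p (maxT T)))%R.

(** The algorithm A_1 : output distribution (probability mass function
    on output words). [ch S T] is the choice rule for a_1 in S \cap T
    (None exactly when S \cap T is empty). *)
Variable ch : {set Sig} -> {set Sig} -> option Sig.
Variable p : R.

(* Q PL PT a k w = P(v_0 a v_1 a ... v_{k-1} a v_K = w) where v_0..v_{k-1}
   are independent with law PL and v_K independent with law PT. *)
Fixpoint Qm (PL PT : seq Sig -> \bar R) (a : Sig) (k : nat) (w : seq Sig)
  : \bar R :=
  match k with
  | 0 => PT w
  | k'.+1 => \sum_(i < size w | nth a w i == a)
               (PL (take i w) * Qm PL PT a k' (drop i.+1 w))
  end.

(* Fuel n = #|S| (the recursion removes one letter from S). *)
Fixpoint A1m (n : nat) (S T : {set Sig}) : seq Sig -> \bar R :=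
  match n with
  | 0 => fun w => ((w == [::])%:R)%:E
  | n'.+1 =>
    match ch S T with
    | None => fun w => ((w == [::])%:R)%:E
    | Some a =>
      let S' := S :\ a in
      let r := (1 - mu S p / mu S' p)%R in
      fun w => \sum_(k <oo)
                 (((1 - r) * r ^+ k)%:E *
                  Qm (A1m n' S' (Lset a)) (A1m n' S' T) a k w)
    end
  end.

Definition A1 (S T : {set Sig}) : seq Sig -> \bar R := A1m #|S| S T.

End Reals.

(** Executions of A_1 and their cost. An execution records, at each call,
    the drawn K (as the number of loop sub-executions), the cost [d] spent
    drawing K, the sub-executions v_0..v_{K-1}, and the final v_K. *)
Variable ch : {set Sig} -> {set Sig} -> option Sig.

Inductive exec : Type :=
| ELeaf : exec
| ENode : nat -> seq exec -> exec -> exec.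

Fixpoint valid (cd : nat) (S T : {set Sig}) (e : exec) : bool :=
  match e with
  | ELeaf => ch S T == None
  | ENode d l e' =>
    match ch S T with
    | None => false
    | Some a =>
      [&& (d <= cd * (size l).+1)%N,
          all (valid cd (S :\ a) (Lset a)) l
        & valid cd (S :\ a) T e']
    end
  end.

Fixpoint out (S T : {set Sig}) (e : exec) : seq Sig :=
  match e with
  | ELeaf => [::]
  | ENode _ l e' =>
    match ch S T with
    | None => [::]
    | Some a =>
      flatten (map (fun v => rcons (out (S :\ a) (Lset a) v) a) l)
        ++ out (S :\ a) T e'
    end
  end.

(* Cost with constant c for each constant-time block: the emptiness test /
   choice / computation of r / initialisation (c), each loop iteration
   (call, assignments, two multiplications: c), the final call, assignment,
   multiplication and return (c); a call with S \cap T empty costs c. *)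
Fixpoint cost (c : nat) (S T : {set Sig}) (e : exec) : nat :=
  match e with
  | ELeaf => c
  | ENode d l e' =>
    match ch S T with
    | None => c
    | Some a =>
      (c + d + sumn (map (fun v => c + cost c (S :\ a) (Lset a) v) l)
        + c + cost c (S :\ a) T e')%N
    end
  end.

End TraceMonoid.

Definition reflexive_symmetric (Sig : finType) (rel : rel Sig) : Prop :=
  (forall a, rel a a) /\ (forall a b, rel a b = rel b a).

Definition choice_rule (Sig : finType)
  (ch : {set Sig} -> {set Sig} -> option Sig) : Prop :=
  forall S T, match ch S T with
              | None => S :&: T == finset.set0
              | Some a => a \in S :&: T
              end.

(* Main.v *)
Require Import Defs.
From HB Require Import structures.
From mathcomp Require Import all_boot all_order all_algebra.
From mathcomp Require Import all_classical all_reals all_analysis.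
From mathcomp Require Import complex polyrcf zify ring.
Import Order.TTheory GRing.Theory Num.Theory.
Import numFieldNormedType.Exports.
Local Open Scope classical_set_scope.
Local Open Scope ring_scope.

(* A trace x over S with max x included in T factors uniquely, for a in S and T,
   as v_0 a v_1 a ... v_K with v_i over S \ a, max v_i included in L(a) for
   i < K and max v_K included in T: v_0 a is the past of the first occurrence
   of a.  Hence each such trace is output by A_1 as exactly one word, its normal
   form.  Since mu_S = mu_(S \ a) - p mu_(S \ L(a)), the weights of the draws
   telescope, and the word w is output with probability
   p^|w| mu_S / mu_(S \ T).  As the output law has total mass 1, the
   normalizing constant of D_(S,T) needs no separate computation.
   For the cost, the K + 1 units of work of a call are paid by the K letters a it
   produces; this gives one factor |out| + 1 for each of the |S| levels. *)

(** * Words modulo commutation *)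

Section Traces.
Variables (Sig : finType) (rel : rel Sig).
Hypothesis relxx : forall a, rel a a.
Hypothesis relC : forall a b, rel a b = rel b a.
Local Notation "u ~~ v" := (tr_eq rel u v) (at level 70).

(** Reduces the congruence to a single swap of adjacent letters. Generalizing over the context [l],
    [r] lets the concatenation rule be applied one factor at a time. *)
Lemma tr_eq_congr (A : Type) (e : A -> A -> Prop) (f : seq Sig -> A) :
  (forall x, e x x) -> (forall x y, e x y -> e y x) ->
  (forall x y z, e x y -> e y z -> e x z) ->
  (forall a b l r, ~~ rel a b -> e (f (l ++ [:: a, b & r])) (f (l ++ [:: b, a & r]))) ->
  forall u v, u ~~ v -> e (f u) (f v).
Proof.
move=> erefl' esym etrans eswap u v uv.
suff /(_ [::] [::]) : forall l r, e (f (l ++ u ++ r)) (f (l ++ v ++ r)).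
  by rewrite /= !cats0.
elim: uv => {u v} [w|u v _ IH|u v w _ IH1 _ IH2|a b ab|u u' v v' _ IHu _ IHv] l r //=.
- exact/esym/IH.
- exact: etrans _ _ _ (IH1 l r) (IH2 l r).
- exact: eswap.
- apply: (etrans _ (f (l ++ (u' ++ v) ++ r))).
    by rewrite -!(catA _ v); exact: IHu.
  by rewrite -!(catA u') !(catA l); exact: IHv.
Qed.

Lemma tr_eq_inv (A : Type) (f : seq Sig -> A) :
  (forall a b l r, ~~ rel a b -> f (l ++ [:: a, b & r]) = f (l ++ [:: b, a & r])) ->
  forall u v, u ~~ v -> f u = f v.
Proof.
by move=> h; apply: (@tr_eq_congr _ eq f) => // x y z -> ->.
Qed.

Lemma tr_eq_perm u v : u ~~ v -> perm_eq u v.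
Proof.
apply: (@tr_eq_congr _ (fun u v => perm_eq u v) id) => [x|x y|x y z|a b l r _].
- exact: perm_refl.
- by rewrite perm_sym.
- exact: perm_trans.
- by rewrite perm_cat2l -[[:: a, b & r]]/([:: a] ++ [:: b] ++ r) perm_catCA.
Qed.

Lemma tr_cons a u v : u ~~ v -> a :: u ~~ a :: v.
Proof. by move=> uv; apply: (@tr_cat _ _ [:: a] [:: a]) uv; exact: tr_refl. Qed.

Lemma tr_commute b u v : all (fun d => ~~ rel b d) u -> b :: u ++ v ~~ u ++ b :: v.
Proof.
elim: u => [_|c u IH] /=; first exact: tr_refl.
case/andP => bc /IH h; apply: tr_trans (tr_cons c _ _ h).
apply: (@tr_cat _ _ [:: b; c] [:: c; b]); last exact: tr_refl.
exact: tr_swap.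
Qed.

(** Boolean counterpart of [tmax] on words. *)
Fixpoint maxb b (w : seq Sig) : bool :=
  if w is c :: w' then maxb b w' || (c == b) && all (fun d => ~~ rel b d) w'
  else false.

Lemma maxb_cat b u v :
  maxb b (u ++ v) = maxb b v || maxb b u && all (fun d => ~~ rel b d) v.
Proof.
elim: u => [|c u IH] /=; first by rewrite orbF.
by rewrite IH all_cat andb_orl orbA andbA.
Qed.

Lemma maxb_tr_eq b u v : u ~~ v -> maxb b u = maxb b v.
Proof.
apply: (@tr_eq_inv _ (maxb b)) => c d l r cd.
have h1 : (c == b) ==> ~~ rel b d by apply/implyP => /eqP <-.
have h2 : (d == b) ==> ~~ rel b c by apply/implyP => /eqP <-; rewrite relC.
rewrite !maxb_cat /=; move: h1 h2.
by case: (c == b); case: (d == b); case: (rel b c); case: (rel b d);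
  case: (maxb b r); case: (maxb b l); case: (all _ r).
Qed.

Lemma maxbP b w : reflect (exists v, w ~~ rcons v b) (maxb b w).
Proof.
apply: (iffP idP) => [|[v /(maxb_tr_eq b) ->]]; last first.
  by rewrite -cats1 maxb_cat /= eqxx.
elim: w => [//|c w IH] /= /orP[/IH[v wv]|/andP[/eqP <- cw]].
  by exists (c :: v); exact: tr_cons.
by exists w; rewrite -cats1 -[c :: w]cats0; exact: tr_commute.
Qed.

(* Past of the first occurrence of [a] and the rest of the trace; the value is
   irrelevant, but still compatible with [tr_eq], if [a] does not occur. *)
Fixpoint cut a (w : seq Sig) : seq Sig * seq Sig :=
  if w is b :: w' then
    if b == a then ([::], w') else
    let: (u, v) := cut a w' in
    if has (rel b) (a :: u) then (b :: u, v) else (u, b :: v)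
  else ([::], [::]).

(** Reading from the right, a letter enters the past when it is related to [a] or to a letter
    already there. Two adjacent unrelated letters do not affect each other's test, so swapping them
    changes each component by at most a swap. *)
Lemma cut_tr_eq a u v : u ~~ v ->
  (cut a u).1 ~~ (cut a v).1 /\ (cut a u).2 ~~ (cut a v).2.
Proof.
apply: (@tr_eq_congr _ (fun x y => x.1 ~~ y.1 /\ x.2 ~~ y.2) (cut a))
  => [x|x y [? ?]|x y z [h1 h2] [h3 h4]|b c l r bc].
- by split; exact: tr_refl.
- by split; exact: tr_sym.
- by split; [exact: tr_trans h1 h3|exact: tr_trans h2 h4].
elim: l => [|d l] /=; last first.
  case: eqP => [_ _|_].
    split; first exact: tr_refl.
    apply: tr_cat; first exact: tr_refl.
    apply: (@tr_cat _ _ [:: b; c] [:: c; b]); last exact: tr_refl.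
    exact: tr_swap.
  case: (cut a _) => u1 v1; case: (cut a _) => u2 v2 /= [hu hv].
  (* The test sees only the set of letters of the past, which [tr_eq] preserves. *)
  rewrite (eq_has_r (perm_mem (tr_eq_perm _ _ hu))).
  by case: ifP => _ /=; split=> //; exact: tr_cons.
have swp w : [:: b, c & w] ~~ [:: c, b & w].
  by apply: (@tr_cat _ _ [:: b; c] [:: c; b]); [exact: tr_swap|exact: tr_refl].
have cb : ~~ rel c b by rewrite relC.
(* If one of the two letters is [a], the other is unrelated to [a] and lands in the rest in both
   orders. *)
case: (eqVneq b a) => [ba|ba].
  have ca : c != a by apply: contraNneq cb => ->; rewrite ba relxx.
  by rewrite (negPf ca) -ba (negPf cb) /=; split; exact: tr_refl.
case: (eqVneq c a) => [ca|ca].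
  by rewrite -ca (negPf bc) /=; split; exact: tr_refl.
case: (cut a r) => p q /=.
have [hb|hb] := boolP (rel b a || has (rel b) p);
have [hc|hc] := boolP (rel c a || has (rel c) p);
  rewrite /= ?(negPf bc) ?(negPf cb) /= ?hb ?hc ?(negPf hb) ?(negPf hc) /=;
  by split; first [exact: swp|exact: tr_refl].
Qed.

(** A letter left out of the past is unrelated to [a] and to the whole past, so it commutes across
    them. A letter put into it is related to [a] or to a later letter of the past, so no maximal
    letter unrelated to [a] appears. *)
Lemma cut_spec a w : a \in w -> let: (u, v) := cut a w in
  [/\ w ~~ u ++ a :: v, a \notin u & forall b, maxb b u -> rel a b].
Proof.
elim: w => [//|b w IH] /=; rewrite inE eq_sym.
case: eqVneq => [-> _|ba /= /IH]; first by split=> //; exact: tr_refl.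
case: (cut a w) => u v [wuv au mu]; case: ifP => hb.
  split; first exact: tr_cons.
  - by rewrite inE eq_sym negb_or ba.
  - move=> c /= /orP[/mu//|/andP[/eqP <- bu]].
    case/orP: hb; first by rewrite relC.
    by case/hasP => d du bd; move/allP: bu => /(_ d du); rewrite bd.
split=> //; apply: (tr_trans (tr_cons _ _ _ wuv)).
rewrite -!(cat_rcons a).
apply: tr_commute; rewrite all_rcons.
by have /norP[-> /=] := negbT hb; rewrite -all_predC.
Qed.

(** A letter of [u] left out by [cut] would be maximal in [u] and unrelated to [a]. *)
Lemma cut_catK a u v : a \notin u -> (forall b, maxb b u -> rel a b) ->
  cut a (u ++ a :: v) = (u, v).
Proof.
elim: u => [|b u IH] /=; first by rewrite eqxx.
rewrite inE negb_or eq_sym => /andP[/negPf -> au] mu.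
rewrite IH // => [|c cu]; last by apply: mu; rewrite cu.
case: ifP => // /negbT; rewrite negb_or => /andP[ba bu].
have /mu : maxb b u || (b == b) && all (fun d => ~~ rel b d) u.
  by rewrite eqxx -[all _ _]/(all (predC (rel b)) u) all_predC bu orbT.
by rewrite relC (negPf ba).
Qed.

End Traces.

Arguments maxb {Sig} rel b w.
Arguments cut {Sig} rel a w.

(** * Normal forms: one output word for each trace *)

Section NormalForms.
Variables (Sig : finType) (rel : rel Sig).
Variable ch : {set Sig} -> {set Sig} -> option Sig.
Local Notation "u ~~ v" := (tr_eq rel u v) (at level 70).

(** Cutting at first occurrences of [a] loses nothing as long as the words of [PL] avoid [a]. *)
Fixpoint star (PL PT : pred (seq Sig)) a k (w : seq Sig) : bool :=
  if k is k'.+1 then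
    [&& a \in w, PL (take (index a w) w)
      & star PL PT a k' (drop (index a w).+1 w)]
  else PT w.

(* [nf #|S| S T] is the set of possible output words of A_1 (p, S, T). *)
Fixpoint nf n (S T : {set Sig}) : pred (seq Sig) :=
  if n is n'.+1 then
    if ch S T is Some a then
      fun w => star (nf n' (S :\ a) (Lset rel a)) (nf n' (S :\ a) T) a (count_mem a w) w
    else pred1 [::]
  else pred1 [::].

Lemma split_index a (w : seq Sig) : a \in w ->
  w = take (index a w) w ++ a :: drop (index a w).+1 w.
Proof.
move=> aw; rewrite -{1}(cat_take_drop (index a w) w) (drop_nth a) ?index_mem //.
by rewrite nth_index.
Qed.

Lemma notin_take_index a (w : seq Sig) : a \notin take (index a w) w.
Proof.
by elim: w => [//|b w IH] /=; case: eqVneq => //= ba; rewrite inE eq_sym negb_or ba.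
Qed.

Lemma starP (PL PT : pred (seq Sig)) a k w :
  star PL PT a k.+1 w ->
  exists u v, [/\ w = u ++ a :: v, a \notin u, PL u & star PL PT a k v].
Proof.
move=> /= /and3P[aw PLu PTv].
exists (take (index a w) w), (drop (index a w).+1 w); split=> //.
  exact: split_index.
exact: notin_take_index.
Qed.

Lemma star_cat (PL PT : pred (seq Sig)) a k u v : a \notin u -> PL u ->
  star PL PT a k v -> star PL PT a k.+1 (u ++ a :: v).
Proof.
move=> au PLu hv; rewrite /= index_cat (negPf au) /= eqxx addn0.
rewrite take_size_cat // PLu mem_cat mem_head orbT.
by rewrite -cat_rcons drop_size_cat ?size_rcons.
Qed.

(** The draw [K] can thus be read off the output word. *)
Lemma star_count (PL PT : pred (seq Sig)) a k w :
  (forall v, PT v -> a \notin v) -> star PL PT a k w -> count_mem a w = k.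
Proof.
move=> aPT; elim: k w => [|k IH] w; first by move/aPT/count_memPn.
case/starP => u [v [-> au _ /IH kv]].
by rewrite count_cat /= eqxx kv (count_memPn au).
Qed.

Hypothesis relxx : forall a, rel a a.
Hypothesis relC : forall a b, rel a b = rel b a.
Hypothesis chP : choice_rule ch.

Lemma chSome S T a : ch S T = Some a -> a \in S /\ a \in T.
Proof. by move=> e; move: (chP S T); rewrite e !inE => /andP. Qed.

Lemma nf_alphabet n S T w : nf n S T w -> {subset w <= S}.
Proof.
elim: n S T w => [|n IH] S T w /=; first by move/eqP ->.
case e: (ch S T) => [a|]; last by move/eqP ->.
have [aS aT] := chSome _ _ _ e.
move: (count_mem a w) => k; elim: k w => {e} [|k IHk] w.
  by move/IH => h x /h; rewrite !inE => /andP[].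
case/starP => u [v [-> _ /IH hu /IHk hv]] x; rewrite mem_cat inE.
by case/or3P => [/hu|/eqP ->//|/hv//]; rewrite !inE => /andP[].
Qed.

Lemma nf_notin n S T a w : nf n (S :\ a) T w -> a \notin w.
Proof. by move/nf_alphabet => h; apply/negP => /h; rewrite !inE eqxx. Qed.

(** A maximal letter of [u ++ a :: v] is maximal in [v], or is [a], or is maximal in [u] and
    commutes with [a]; the last case contradicts the induction hypothesis for [u], whose target set
    is [Lset rel a]. *)
Lemma nf_max n S T w : nf n S T w -> forall b, maxb rel b w -> b \in T.
Proof.
elim: n S T w => [|n IH] S T w /=; first by move/eqP ->.
case e: (ch S T) => [a|]; last by move/eqP ->.
have [aS aT] := chSome _ _ _ e.
move: (count_mem a w) => k; elim: k w => {e} [|k IHk] w; first exact: IH.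
case/starP => u [v [-> _ /IH hu /IHk hv]] b.
rewrite maxb_cat /= => /orP[/orP[/hv//|/andP[/eqP <-//]]|/and3P[/hu]].
by rewrite inE relC => ->.
Qed.

(** On a normal form [cut] returns [v_0] and the remaining word, and it sends equivalent words to
    equivalent pieces. *)
Lemma nf_uniq n S T w w' : nf n S T w -> nf n S T w' -> w ~~ w' -> w = w'.
Proof.
elim: n S T w w' => [|n IH] S T w w' /=; first by move=> /eqP -> /eqP ->.
case e: (ch S T) => [a|]; last by move=> /eqP -> /eqP ->.
(* Equivalent words contain equally many [a], so both unfold with the same [k]. *)
move=> + + ww'; rewrite -(permP (tr_eq_perm _ _ _ _ ww')).
move: (count_mem a w) => k; elim: k w w' ww' => {e} [|k IHk] w w' ww'.
  by move=> h h'; exact: IH h h' ww'.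
case/starP => u [v [ew au hu hv]] /starP[u' [v' [ew' au' hu' hv']]].
have mx x : nf n (S :\ a) (Lset rel a) x -> forall b, maxb rel b x -> rel a b.
  by move=> hx b /(nf_max _ _ _ _ hx); rewrite inE.
have [] := cut_tr_eq _ _ relxx relC a _ _ ww'.
rewrite ew ew' !(cut_catK _ _ relC) //=; [|exact: mx..].
move=> uu' vv'; congr (_ ++ _ :: _); first exact: IH hu hu' uu'.
exact: IHk.
Qed.

(** Repeated use of [cut] splits off the blocks before each [a]; each block is replaced by its
    normal form over [S :\ a]. *)
Lemma nf_exist n (S T : {set Sig}) (w : seq Sig) : #|S| = n -> {subset w <= S} ->
  (forall b, maxb rel b w -> b \in T) -> exists2 w', nf n S T w' & w ~~ w'.
Proof.
elim: n S T w => [|n IH] S T w cS wS wT.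
  exists [::] => //; case: w wS {wT} => [|b w wS]; first by move=> _; exact: tr_refl.
  by have := wS b (mem_head _ _); rewrite (cards0_eq cS) inE.
rewrite /=; have := chP S T; case e: (ch S T) => [a|]; last first.
  move=> /eqP ST; exists [::] => //.
  case: w wS wT => [|b w] wS wT; first exact: tr_refl.
  (* A nonempty word has a maximal letter, its last one, which would lie in the empty set
     [S :&: T]. *)
  have [c cw] : exists c, maxb rel c (b :: w).
    elim: w b {wS wT} => [|c w IHw] b; first by exists b; rewrite /= eqxx.
    by have [d dw] := IHw c; exists d; rewrite -cat1s maxb_cat dw.
  have cST : c \in S :&: T.
    rewrite inE wT // andbT; apply: wS.
    have [v /tr_eq_perm/perm_mem ->] := elimT (maxbP _ _ relC c (b :: w)) cw.
    by rewrite mem_rcons mem_head.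
  by rewrite ST inE in cST.
rewrite inE => /andP[aS aT].
have cS' : #|S :\ a| = n by apply/eqP; rewrite -eqSS -cS (cardsD1 a S) aS.
suff [w' h ww'] : exists2 w',
    star (nf n (S :\ a) (Lset rel a)) (nf n (S :\ a) T) a (count_mem a w) w' & w ~~ w'.
  by exists w' => //; rewrite -(permP (tr_eq_perm _ _ _ _ ww')).
have [k ek] : exists k, count_mem a w = k by exists (count_mem a w).
rewrite ek; elim: k w ek wS wT => [|k IHk] w ek wS wT.
  apply: IH => // x xw; rewrite !inE wS // andbT.
  by apply: contraTneq xw => ->; apply/count_memPn.
have aw : a \in w by rewrite -has_pred1 has_count ek.
have := cut_spec _ _ relC _ _ aw; case: (cut rel a w) => u v [wuv au mu].
have wE := perm_mem (tr_eq_perm _ _ _ _ wuv).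
have [u' hu' uu'] : exists2 u', nf n (S :\ a) (Lset rel a) u' & u ~~ u'.
  apply: IH => // [x xu|b /mu]; last by rewrite inE.
  rewrite !inE wS ?wE ?mem_cat ?xu // andbT.
  by apply: contraTneq xu => ->.
have [v' hv' vv'] : exists2 v',
    star (nf n (S :\ a) (Lset rel a)) (nf n (S :\ a) T) a k v' & v ~~ v'.
  apply: IHk.
  - move: ek; rewrite (permP (tr_eq_perm _ _ _ _ wuv)) count_cat /= eqxx.
    by rewrite (count_memPn au) => -[].
  - by move=> x xv; rewrite wS // wE mem_cat inE xv !orbT.
  - move=> b bv; apply: wT.
    by rewrite (maxb_tr_eq _ _ relC _ _ _ wuv) maxb_cat /= bv.
exists (u' ++ a :: v'); first by apply: star_cat => //; exact: nf_notin hu'.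
by apply: tr_trans wuv _; apply: tr_cat => //; exact: tr_cons.
Qed.

End NormalForms.

Arguments star {Sig} PL PT a k w.
Arguments nf {Sig} rel ch n S T w.

(** * Cost of an execution *)

Section Cost.
Variables (Sig : finType) (rel : rel Sig).
Variable ch : {set Sig} -> {set Sig} -> option Sig.
Hypothesis chP : choice_rule ch.

(** Apart from its sub-executions, a call with draw [K] spends [2 * c] outside the loop, at most
    [cd * (K + 1)] on the draw and [c] per iteration, hence at most [(2 * c + cd) * (K + 1)]. *)
Lemma cost_le c cd S T e : valid rel ch cd S T e ->
  (cost rel ch c S T e
     <= (2 * c + cd) * (#|S| + 1) * (size (out rel ch S T e) + 1))%N.
Proof.
have [n cS] : exists n, #|S| = n by exists #|S|.
elim: n S T e cS => [|n IH] S T [|d l e] cS /=; rewrite cS.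
- by nia.
- have := chP S T; case: (ch S T) => // a; rewrite inE => /andP[aS _].
  by rewrite (cards0_eq cS) inE in aS.
- by nia.
have := chP S T; case: (ch S T) => // a; rewrite inE => /andP[aS _].
have cS' : #|S :\ a| = n by apply/eqP; rewrite -eqSS -cS (cardsD1 a S) aS.
case/and3P => hd hl /(IH _ _ _ cS'); rewrite size_cat cS'.
move: (cost _ _ _ _ _ e) (size (out _ _ _ _ e)) => ce se he.
set sf := size (flatten _); set sc := sumn _.
(* The [a] appended to each [v_i] absorbs the [+ 1] of its inductive bound, so these bounds add up
   to a multiple of [sf]. *)
have [hsc hsf] : (sc <= c * size l + (2 * c + cd) * (n + 1) * sf /\ size l <= sf)%N.
  rewrite {}/sc {}/sf; elim: l hl {hd} => [|v l IHl] //= /andP[hv /IHl[h1 h2]].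
  move: hv => /(IH _ _ _ cS'); rewrite size_cat size_rcons cS'.
  by move: (cost _ _ _ _ _ v) (size (out _ _ _ _ v)) h1 h2 => x y; nia.
by nia.
Qed.

End Cost.

(** * Moebius polynomials *)

Section Mobius.
Variables (R : realType) (Sig : finType) (rel : rel Sig).
Hypothesis relxx : forall a, rel a a.
Hypothesis relC : forall a b, rel a b = rel b a.
Implicit Types (S X g : {set Sig}) (x t p : R).

Lemma muE S x :
  mu rel S x = \sum_(g : {set Sig} | (g \subset S) && clique rel g) (- x) ^+ #|g|.
Proof.
rewrite /mu /muP horner_sum; apply: eq_bigr => g _.
by rewrite hornerZ hornerXn -exprMn mulN1r.
Qed.

Lemma cliqueP g :
  reflect (forall a b, a \in g -> b \in g -> rel a b -> a = b) (clique rel g).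
Proof.
apply: (iffP forall_inP) => [h a b ag bg ab|h a ag].
  by have /forall_inP/(_ b bg) := h a ag; rewrite ab /= => /eqP.
apply/forall_inP => b bg; case: (boolP (rel a b)) => //= ab.
by apply/eqP; exact: h.
Qed.

Lemma clique_setU1 a g : a \notin g ->
  clique rel (a |: g) = clique rel g && (g \subset ~: Lset rel a).
Proof.
move=> ag; apply/cliqueP/andP => [h|[/cliqueP h /fintype.subsetP gL] b c].
  split; first by apply/cliqueP => b c bg cg; apply: h; rewrite !inE ?bg ?cg orbT.
  apply/fintype.subsetP => b bg; rewrite !inE; apply/negP => ab.
  have eab : a = b by apply: h; rewrite ?inE ?eqxx ?bg ?orbT.
  by rewrite eab bg in ag.
rewrite !inE => /orP[/eqP ->|bg] /orP[/eqP ->|cg] //.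
- by have := gL c cg; rewrite !inE => /negPf ->.
- by have := gL b bg; rewrite !inE relC => /negPf ->.
- exact: h.
Qed.

(** Cliques containing [a] are the sets [a |: g] with [g] a clique of [S :\: Lset rel a]; the
    additional letter contributes the factor [- x]. *)
Lemma mu_rec S a x : a \in S ->
  mu rel S x = mu rel (S :\ a) x - x * mu rel (S :\: Lset rel a) x.
Proof.
move=> aS; rewrite !muE (bigID (fun g : {set Sig} => a \in g)) /= addrC.
congr (_ + _).
  by apply: eq_bigl => g; rewrite subsetD1 andbAC.
rewrite -mulNr big_distrr /=.
rewrite (reindex_onto (fun g : {set Sig} => a |: g) (fun g => g :\ a)) /=; last first.
  by move=> g /andP[_ ag]; rewrite finset.setD1K.
have h (g : {set Sig}) : ((a |: g) :\ a == g) = (a \notin g).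
  apply/eqP/idP => [<-|ag]; first by rewrite !inE eqxx.
  by rewrite setU1K.
rewrite (eq_bigl (fun g => (g \subset S :\: Lset rel a) && clique rel g)) => [|g].
  apply: eq_bigr => g /andP[/fintype.subsetP gS _]; rewrite cardsU1.
  have -> : a \notin g by apply/negP => /gS; rewrite !inE relxx.
  by rewrite exprS.
rewrite h setU11 andbT finset.subUset finset.sub1set aS /=.
rewrite finset.setDE finset.subsetI.
have [ag|ag] := boolP (a \in g); last first.
  by rewrite clique_setU1 // andbT andbA andbAC.
rewrite andbF; apply/esym/negbTE/negP => /andP[/andP[_ /fintype.subsetP gL] _].
by have := gL a ag; rewrite !inE relxx.
Qed.

Lemma mu0 S : mu rel S 0 = 1 :> R.
Proof.
rewrite muE (bigD1 finset.set0) /=; last first.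
  by rewrite finset.sub0set; apply/cliqueP => a b; rewrite inE.
rewrite cards0 expr0 big1 ?addr0 // => g /andP[_ g0].
by rewrite oppr0 expr0n cards_eq0 (negPf g0).
Qed.

Lemma muP_neq0 S : muP rel R S != 0.
Proof.
apply/eqP => h; have := mu0 S; rewrite /mu h horner0 => /esym/eqP.
by rewrite oner_eq0.
Qed.

(* At the smallest zero [y] of [mu (S :\ a)] the recursion gives
   [mu S y = - y * mu (S :\: Lset a) y <= 0]. *)
Lemma mu_gt0_subset S X p : (forall t, 0 <= t <= p -> 0 < mu rel S t) ->
  X \subset S -> forall t, 0 <= t <= p -> 0 < mu rel X t.
Proof.
have [n] := ubnP #|S|; elim: n => // n IH in S X p *; rewrite ltnS => cS Spos XS.
have [-> //|XneS] := eqVneq X S.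
have [a aS aX] : exists2 a, a \in S & a \notin X.
  have : X \proper S by rewrite finset.properEneq XneS.
  by case/properP.
have cS' : (#|S :\ a| < n)%N by move: cS; rewrite (cardsD1 a S) aS.
have XS' : X \subset S :\ a by rewrite subsetD1 XS.
apply: (IH (S :\ a) X p) => // t /andP[t0 tp].
rewrite ltNge; apply/negP => mut.
set P := muP rel R (S :\ a).
have P0 : P.[0] = 1 by exact: mu0.
have {}t0 : 0 < t.
  rewrite lt_neqAle t0 andbT; apply: contraTneq mut => <-.
  by rewrite -ltNge mu0 ltr01.
(* [y] is the next root of [P] after [0], or [t] if there is none before [t]; then [P] vanishes at
   [t], since a negative value would force an earlier root. *)
have [y [y0 yt Py noroot]] : exists y, [/\ 0 < y, y <= t, P.[y] = 0 &
    {in `]0, y[, forall z, ~~ root P z}].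
  case: (next_rootP P 0 t) => [PE|y _ Py|_ _ _ noroot].
  - by have := muP_neq0 (S :\ a); rewrite -/P PE eqxx.
  - by rewrite in_itv /= => /andP[y0 /ltW yt] ?; exists y.
  exists t; split=> //; apply/eqP; move: (mut); rewrite le_eqVlt => /orP[//|Pt].
  have [||z zt rz] := @poly_ivtoo _ P 0 t; first exact: ltW.
    by rewrite P0 mul1r.
  by have := noroot z zt; rewrite rz.
have pos s : 0 <= s < y -> 0 < P.[s].
  move=> /andP[s0 sy].
  move: s0; rewrite le_eqVlt => /orP[/eqP <-|s0]; first by rewrite P0.
  have nrs z : 0 < z <= s -> ~~ root P z.
    move=> /andP[z0 zs]; apply: noroot.
    by rewrite in_itv /= z0 (le_lt_trans zs sy).
  case: (ltgtP 0 P.[s]) => // [Ps|/esym/eqP Ps]; last first.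
    by have := nrs s; rewrite s0 lexx rootE Ps => /(_ isT).
  have [||z] := @poly_ivtoo _ P 0 s; first exact: ltW.
    by rewrite P0 mul1r.
  rewrite in_itv /= => /andP[z0 /ltW zs] rz.
  by have := nrs z; rewrite z0 zs rz => /(_ isT).
set Q := muP rel R (S :\: Lset rel a).
(* [P] is known to be positive only before [y], so the induction hypothesis covers [Q] only there;
   the intermediate value theorem then gives [0 <= Q.[y]]. *)
have Qpos s : 0 <= s < y -> 0 < Q.[s].
  move=> /andP[s0 sy]; apply: (IH (S :\ a) _ s) => //.
  - by move=> u /andP[u0 us]; apply: pos; rewrite u0 (le_lt_trans us sy).
  - apply/fintype.subsetP => b; rewrite !inE => /andP[ab ->]; rewrite andbT.
    by apply: contraNneq ab => ->.
  - by rewrite s0 lexx.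
have : 0 <= Q.[y].
  rewrite leNgt; apply/negP => Qy.
  have [||z] := @poly_ivtoo _ Q 0 y; first exact: ltW.
    by rewrite pmulr_rlt0 //; apply: Qpos; rewrite lexx.
  rewrite in_itv /= => /andP[z0 zy]; rewrite rootE => /eqP rz.
  by have := Qpos z; rewrite (ltW z0) zy rz ltxx => /(_ isT).
have := Spos y; rewrite (ltW y0) (le_trans yt tp) => /(_ isT).
rewrite (mu_rec _ _ _ aS) /mu -/P -/Q Py sub0r oppr_gt0 => h1 h2.
by have := mulr_ge0 (ltW y0) h2; rewrite leNgt h1.
Qed.

(** A zero of [mu rel S] in [[0, p]] would be a complex root of modulus at most [p], so [mu rel S]
    stays positive from its value [1] at [0]. Passing to subsets takes the place of comparing [p_S]
    with [p_X]. *)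
Lemma in_0_pS_mu_gt0 S p : in_0_pS rel S p ->
  forall X, X \subset S -> 0 < mu rel X p.
Proof.
move=> [p0 hroot] X XS; apply: (mu_gt0_subset S X p) => //; last first.
  by rewrite (ltW p0) lexx.
move=> t /andP[t0 tp]; rewrite ltNge; apply/negP => mut.
have [|x] := @polyrcf.poly_ivt _ (muP rel R S) 0 t t0.
  by rewrite -[X in X * _]/(mu rel S 0) mu0 mul1r.
rewrite in_itv /= => /andP[x0 xt] rx.
have : root (map_poly (real_complex R) (muP rel R S)) (real_complex R x).
  by rewrite fmorph_root.
move=> /hroot; rewrite ger0_norm ?ler0c // ltcR.
by rewrite ltNge (le_trans xt tp).
Qed.

End Mobius.

(** * Law of the output *)

Section Esum.
Variables (R : realType) (T : choiceType).
Local Open Scope ereal_scope.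
Implicit Types (D : set T) (f : T -> \bar R).

Lemma esumZl D f (c : R) : (0 <= c)%R -> (forall x, D x -> 0 <= f x) ->
  \esum_(x in D) (c%:E * f x) = c%:E * \esum_(x in D) f x.
Proof.
have le (d : R) (g : T -> \bar R) : (0 <= d)%R -> (forall x, D x -> 0 <= g x) ->
    \esum_(x in D) (d%:E * g x) <= d%:E * \esum_(x in D) g x.
  move=> d0 g0; apply: ge_ereal_sup => _ [X [finX XD] <-].
  (* [g] is nonnegative only on [D]; its positive part agrees with it there and is nonnegative
     everywhere. *)
  rewrite (eq_fsbigr (fun x => d%:E * Order.max 0 (g x))); last first.
    by move=> x; rewrite inE => /XD /g0 gx; rewrite max_r.
  rewrite -ge0_mule_fsumr => [|x]; last by rewrite le_max lexx.
  apply: lee_wpmul2l; first by rewrite lee_fin.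
  apply: ereal_sup_ubound; exists X => //.
  by apply: eq_fsbigr => x; rewrite inE => /XD /g0 gx; rewrite max_r.
rewrite le_eqVlt => /orP[/eqP <- f0|c0 f0].
  by rewrite mul0e esum1 // => x _; rewrite mul0e.
apply/eqP; rewrite eq_le; apply/andP; split; first by apply: le => //; exact: ltW.
rewrite -lee_pdivlMl //.
rewrite (@eq_esum _ _ D f (fun x => (c^-1)%:E * (c%:E * f x))).
  apply: le; first by rewrite invr_ge0 ltW.
  by move=> x Dx; rewrite mule_ge0 ?lee_fin ?f0 // ltW.
by move=> x _; rewrite muleA -EFinM mulVf ?mul1e // gt_eqF.
Qed.

Lemma esum_single D f x0 : D x0 -> 0 <= f x0 ->
  (forall x, D x -> x <> x0 -> f x = 0) -> \esum_(x in D) f x = f x0.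
Proof.
move=> Dx0 fx0 f0; rewrite -(@esum_set1 _ _ x0) // [LHS]esum_mkcond [RHS]esum_mkcond.
apply: eq_esum => x _; case: (eqVneq x x0) => [->|/eqP xx0].
  by rewrite !mem_set.
rewrite [x \in [set x0]]memNset //.
by case: ifPn => // /set_mem Dx; exact: f0.
Qed.

End Esum.

Lemma geometric_mass (R : realType) (r : R) : 0 <= r < 1 ->
  (\sum_(k <oo) ((1 - r) * r ^+ k)%:E = 1)%E.
Proof.
move=> /andP[r0 r1]; have nr : `|r| < 1 by rewrite ger0_norm.
have cv := @cvg_geometric_series _ (1 - r) r nr.
rewrite (_ : (fun n => _) = EFin \o series (geometric (1 - r) r)).
  rewrite EFin_lim; last exact: is_cvg_geometric_series.
  by rewrite (cvg_lim _ cv) // divff // subr_eq0 gt_eqF.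
by apply/funext => n /=; rewrite /series /= sumEFin.
Qed.

(** * Mass and weights of the unrolled loop *)

Section Law.
Variables (R : realType) (Sig : finType).
Local Open Scope ereal_scope.
Implicit Types (PL PT : seq Sig -> \bar R) (a : Sig) (k : nat) (w : seq Sig).

(** Ending the first block at a later occurrence of [a] would put an [a] inside that block, where
    [PL] vanishes. *)
Lemma QmS PL PT a k w : (forall u, a \in u -> PL u = 0) ->
  Qm PL PT a k.+1 w =
  if a \in w then
    PL (take (index a w) w) * Qm PL PT a k (drop (index a w).+1 w)
  else 0.
Proof.
move=> PL0 /=; case: ifPn => aw; last first.
  apply: big1 => i /eqP ai; case/negP: aw.
  by rewrite -ai mem_nth.
have iw : (index a w < size w)%N by rewrite index_mem.
rewrite (bigD1 (Ordinal iw)) /=; last by rewrite nth_index.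
rewrite big1 ?adde0 // => i /andP[/eqP ai ne].
rewrite PL0 ?mul0e //.
have lt : (index a w < i)%N.
  rewrite ltn_neqAle; apply/andP; split.
    by apply: contraNneq ne => e; apply/eqP/val_inj.
  by rewrite leqNgt; apply/negP => /(before_find a) /=; rewrite ai eqxx.
rewrite -[X in X \in _](nth_index a aw) -(nth_take _ lt).
by rewrite mem_nth // size_take ltn_ord.
Qed.

Lemma Qm_ge0 PL PT a k w : (forall u, 0 <= PL u) -> (forall u, 0 <= PT u) ->
  0 <= Qm PL PT a k w.
Proof.
move=> PL0 PT0; elim: k w => [|k IH] w //=.
by apply: sume_ge0 => i _; rewrite mule_ge0.
Qed.

(** The map from [(u, v)] to [u ++ a :: v] is a bijection from the pairs with [a] not in [u] onto
    the words containing [a], so the sum factors into the masses of the first block and of the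
    rest. *)
Lemma Qm_mass PL PT a k :
  (forall u, PL u \is a fin_num) ->
  (forall u, 0 <= PL u) -> (forall u, 0 <= PT u) ->
  (forall u, a \in u -> PL u = 0) ->
  \esum_(u in setT) PL u = 1 -> \esum_(u in setT) PT u = 1 ->
  \esum_(w in setT) Qm PL PT a k w = 1.
Proof.
move=> PLfin PL0 PT0 aPL mL mT; elim: k => [//|k IH].
under eq_esum do rewrite QmS //.
transitivity (\esum_(w in [set w : seq Sig | a \in w])
   (PL (take (index a w) w) * Qm PL PT a k (drop (index a w).+1 w))).
  rewrite [RHS]esum_mkcond; apply: eq_esum => w _.
  by case: ifPn => aw; [rewrite mem_set|rewrite memNset //=; exact/negP].
rewrite (reindex_esum ([set u : seq Sig | a \notin u] `*`` (fun=> setT)) _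
  (fun uv : seq Sig * seq Sig => uv.1 ++ a :: uv.2)); last first.
  split.
  - by move=> [u v] _ /=; rewrite mem_cat mem_head orbT.
  - move=> [u v] [u' v']; rewrite !inE /= => -[au _] [au' _].
    elim: u u' au au' => [|b u IHu] [|b' u'] //=.
    + by move=> _ _ [->].
    + by rewrite inE negb_or => _ /andP[/eqP ab' _] [].
    + by rewrite inE negb_or => /andP[/eqP ab _] _ [/esym].
    + rewrite !inE !negb_or => /andP[_ au] /andP[_ au'] [-> e].
      by have [-> ->] := IHu u' au au' e.
  - move=> w /= aw; exists (take (index a w) w, drop (index a w).+1 w) => /=.
      by split=> //; exact: notin_take_index.
    by rewrite -split_index.
rewrite (@eq_esum _ _ _ _ (fun uv => PL uv.1 * Qm PL PT a k uv.2)); last first.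
  move=> [u v] [/= au _]; rewrite index_cat (negPf au) /= eqxx addn0.
  by rewrite take_size_cat // -cat_rcons drop_size_cat ?size_rcons.
rewrite -(@esum_esum _ _ _ _ (fun=> setT) (fun u v => PL u * Qm PL PT a k v)); last first.
  by move=> u v _ _; rewrite mule_ge0 // Qm_ge0.
rewrite (@eq_esum _ _ _ _ PL) => [|u _]; last first.
  rewrite -(fineK (PLfin u)) esumZl ?IH ?mule1 //.
    by rewrite fine_ge0.
  by move=> v _; rewrite Qm_ge0.
rewrite -mL esum_mkcond; apply: eq_esum => u _.
case: ifPn => // /negP; rewrite in_setE /= => /negP; rewrite negbK.
by move/aPL ->.
Qed.

(** Each factor [r] merges with the constant [cL] of one block into the weight [p] of the [a]
    closing it; only [cT] and a power of [p] remain. *)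
Lemma Qm_star (nL nT : pred (seq Sig)) PL PT a (cL cT r p : R) k w :
  (forall u, nL u -> a \notin u) ->
  (forall u, PL u = if nL u then (cL * p ^+ size u)%:E else 0) ->
  (forall u, PT u = if nT u then (cT * p ^+ size u)%:E else 0) ->
  (r * cL = p)%R ->
  (r ^+ k)%:E * Qm PL PT a k w
    = if star nL nT a k w then (cT * p ^+ size w)%:E else 0.
Proof.
move=> anL PLE PTE rp; elim: k w => [|k IH] w.
  by rewrite expr0 mul1e /= PTE.
rewrite QmS => [|u au]; last by rewrite PLE; case: ifP => // /anL; rewrite au.
rewrite [star _ _ _ _ _]/=; case: ifPn => aw; last by rewrite mule0.
rewrite /= PLE; case: ifP => /= _; last by rewrite mul0e mule0.
have -> : (r ^+ k.+1)%:E * ((cL * p ^+ size (take (index a w) w))%:E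
      * Qm PL PT a k (drop (index a w).+1 w))
    = (p ^+ (size (take (index a w) w)).+1)%:E
      * ((r ^+ k)%:E * Qm PL PT a k (drop (index a w).+1 w)).
  rewrite !muleA -!EFinM !exprS; congr (_%:E * _).
  by rewrite -[X in _ = (X * _ * _)%R]rp; ring.
rewrite IH; case: ifP => _; last by rewrite mule0.
have -> : size w = ((size (take (index a w) w)).+1 + size (drop (index a w).+1 w))%N.
  by rewrite {1}(split_index _ _ _ aw) size_cat /= addSnnS.
by rewrite -EFinM mulrCA -exprD.
Qed.

End Law.

Lemma esum_exchange (R : realType) (T T' : choiceType) (f : T -> T' -> \bar R) :
  (forall i j, 0 <= f i j)%E ->
  \esum_(i in setT) \esum_(j in setT) f i j = \esum_(j in setT) \esum_(i in setT) f i j.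
Proof.
move=> f0; rewrite !esum_esum //.
rewrite (reindex_esum ([set: T'] `*`` (fun=> [set: T])) _ (fun x => (x.2, x.1))) //.
split=> //; first by move=> [? ?] [? ?] _ _ [-> ->].
by move=> [i j] _; exists (j, i).
Qed.

(** * Output probabilities, normalizing constant and law on traces *)

Section Output.
Variables (R : realType) (Sig : finType) (rel : rel Sig).
Variable ch : {set Sig} -> {set Sig} -> option Sig.
Variable p : R.
Hypothesis relxx : forall a, rel a a.
Hypothesis relC : forall a b, rel a b = rel b a.
Hypothesis chP : choice_rule ch.
Hypothesis p_gt0 : 0 < p.
Implicit Types (S T : {set Sig}) (a : Sig) (w : seq Sig).

Definition mu_pos S := forall X : {set Sig}, X \subset S -> 0 < mu rel X p.

Lemma mu_posD1 S a : mu_pos S -> mu_pos (S :\ a).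
Proof. by move=> h X; rewrite subsetD1 => /andP[/h]. Qed.

(** By [mu_rec], [r * mu (S :\ a)] equals [p * mu (S :\: Lset a)], which gives the sign of [r] and
    the last identity; the latter is the relation [r * cL = p] required by [Qm_star]. *)
Lemma ratio_geometric S a : mu_pos S -> a \in S ->
  let r := 1 - mu rel S p / mu rel (S :\ a) p in
  [/\ 0 <= r < 1, 1 - r = mu rel S p / mu rel (S :\ a) p
    & r * (mu rel (S :\ a) p / mu rel ((S :\ a) :\: Lset rel a) p) = p].
Proof.
move=> hS aS r.
have hS' : 0 < mu rel (S :\ a) p by apply: hS; exact: subD1set.
have hL : 0 < mu rel ((S :\ a) :\: Lset rel a) p.
  by apply: hS; rewrite (fintype.subset_trans (finset.subsetDl _ _)) // subD1set.
have eL : (S :\ a) :\: Lset rel a = S :\: Lset rel a.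
  apply/setP => b; rewrite !inE; case: (eqVneq b a) => [->|//].
  by rewrite relxx.
have muS := mu_rec R Sig rel relxx relC S a p aS.
rewrite -eL in muS.
have rE : r * mu rel (S :\ a) p = p * mu rel ((S :\ a) :\: Lset rel a) p.
  by rewrite mulrBl mul1r divfK ?gt_eqF // muS; ring.
split.
- apply/andP; split.
    by rewrite -(pmulr_lge0 _ hS') rE mulr_ge0 // ltW.
  by rewrite ltrBlDr ltrDl divr_gt0 // hS.
- by rewrite /r; ring.
- by rewrite mulrA rE mulfK // gt_eqF.
Qed.

Lemma setDD1 S T a : a \in T -> (S :\ a) :\: T = S :\: T.
Proof.
move=> aT; apply/setP => b; rewrite !inE; case: (eqVneq b a) => [->|//].
by rewrite aT.
Qed.

Lemma card_setD1 n S a : #|S| = n.+1 -> a \in S -> #|S :\ a| = n.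
Proof. by move=> cS aS; apply/eqP; rewrite -eqSS -cS (cardsD1 a S) aS. Qed.

(** A word determines [K], so at most one term of the series survives. *)
Lemma A1m_nf n S T w : #|S| = n -> mu_pos S ->
  A1m rel ch p n S T w =
  if nf rel ch n S T w then (mu rel S p / mu rel (S :\: T) p * p ^+ size w)%:E else 0%E.
Proof.
have leaf X Y v : mu_pos X -> X :&: Y = finset.set0 -> ((v == [::])%:R)%:E =
    if v == [::] then (mu rel X p / mu rel (X :\: Y) p * p ^+ size v)%:E else 0%E.
  move=> hX XY; have -> : X :\: Y = X.
    by apply/finset.setDidPl; rewrite -setI_eq0 XY.
  rewrite divff ?gt_eqF ?hX // mul1r.
  by case: eqP => [->|//]; rewrite expr0.
elim: n S T w => [|n IH] S T w cS hS.
  by apply: leaf => //; rewrite (cards0_eq cS) finset.set0I.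
rewrite /=; have := chP S T; case e: (ch S T) => [a|]; last first.
  by move=> /eqP; exact: leaf.
rewrite inE => /andP[aS aT].
have cS' := card_setD1 _ _ _ cS aS.
have [] := ratio_geometric S a hS aS.
set S' := S :\ a; set r := 1 - mu rel S p / mu rel S' p => r01 r1 rp.
have hS' : mu_pos S' by exact: mu_posD1.
pose cT := mu rel S' p / mu rel (S' :\: T) p.
have term k : (((1 - r) * r ^+ k)%:E *
    Qm (A1m rel ch p n S' (Lset rel a)) (A1m rel ch p n S' T) a k w =
  if star (nf rel ch n S' (Lset rel a)) (nf rel ch n S' T) a k w
  then ((1 - r) * (cT * p ^+ size w))%:E else 0)%E.
  rewrite EFinM -muleA (@Qm_star _ _ (nf rel ch n S' (Lset rel a))
    (nf rel ch n S' T) _ _ _ (mu rel S' p / mu rel (S' :\: Lset rel a) p) cT _ p) //.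
  - by case: ifP => _; rewrite ?mule0.
  - by move=> u; exact: nf_notin.
  - by move=> u; exact: IH.
  - by move=> u; exact: IH.
rewrite (eq_eseriesr (fun k _ => term k)).
have pos : 0 <= (1 - r) * (cT * p ^+ size w).
  rewrite mulr_ge0 ?subr_ge0 //; first by case/andP: r01 => _ /ltW.
  rewrite mulr_ge0 ?exprn_ge0 // ?(ltW p_gt0) // ltW // divr_gt0 ?hS' //.
  exact: finset.subsetDl.
rewrite nneseries_esumT => [|k]; last by case: ifP; rewrite ?lee_fin.
have starE k : star (nf rel ch n S' (Lset rel a)) (nf rel ch n S' T) a k w ->
    count_mem a w = k.
  by apply: star_count => u; exact: nf_notin.
case: ifPn => hw; last first.
  by apply: esum1 => k _; case: ifP => // sk; rewrite (starE k) ?sk in hw.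
rewrite (@esum_single _ _ _ _ (count_mem a w)) // ?hw //; last first.
  by move=> k _ kc; case: ifP => // /starE /esym.
(* [1 - r] is [mu S / mu S'] and [cT] is [mu S' / mu (S' :\: T)]; moreover [S' :\: T] is [S :\: T]
   because [a] lies in [T]. *)
congr (_%:E); rewrite r1 /cT setDD1 // !mulrA; congr (_ / _ * _).
by rewrite divfK // gt_eqF // hS'.
Qed.

Lemma A1m_ge0 n S T w : #|S| = n -> mu_pos S -> (0 <= A1m rel ch p n S T w)%E.
Proof.
move=> cS hS; rewrite A1m_nf //; case: ifP => // _.
rewrite lee_fin mulr_ge0 ?exprn_ge0 // ?(ltW p_gt0) // ltW // divr_gt0 ?hS //.
exact: finset.subsetDl.
Qed.

(** After exchanging the sums, each value of [K] contributes its geometric weight times [1], by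
    [Qm_mass]. *)
Lemma A1m_mass n S T : #|S| = n -> mu_pos S ->
  \esum_(w in setT) A1m rel ch p n S T w = 1%E.
Proof.
have leaf : \esum_(w in [set: seq Sig]) ((w == [::])%:R)%:E = 1%E :> \bar R.
  rewrite (@esum_single _ _ _ _ [::]) ?eqxx //.
  by move=> w _ /eqP/negPf ->.
elim: n S T => [|n IH] S T cS hS /=; first exact: leaf.
have := chP S T; case: (ch S T) => [a|]; last by rewrite leaf.
rewrite inE => /andP[aS aT].
have cS' := card_setD1 _ _ _ cS aS.
have [] := ratio_geometric S a hS aS.
set S' := S :\ a; set r := 1 - mu rel S p / mu rel S' p => r01 r1 rp.
have hS' : mu_pos S' by exact: mu_posD1.
have /andP[r0 rlt1] := r01.
have g0 k : 0 <= (1 - r) * r ^+ k by rewrite mulr_ge0 ?exprn_ge0 // subr_ge0 ltW.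
have Q0 k w : (0 <= Qm (A1m rel ch p n S' (Lset rel a)) (A1m rel ch p n S' T) a k w)%E.
  by apply: Qm_ge0 => u; exact: A1m_ge0.
transitivity (\esum_(w in [set: seq Sig]) \esum_(k in [set: nat])
    (((1 - r) * r ^+ k)%:E
      * Qm (A1m rel ch p n S' (Lset rel a)) (A1m rel ch p n S' T) a k w)%E).
  apply: eq_esum => w _; rewrite nneseries_esumT // => k.
  by rewrite mule_ge0 ?lee_fin.
rewrite esum_exchange; last by move=> w k; rewrite mule_ge0 ?lee_fin.
rewrite -(geometric_mass _ _ r01) nneseries_esumT //.
apply: eq_esum => k _; rewrite esumZl // Qm_mass ?mule1 //.
- by move=> u; rewrite A1m_nf //; case: ifP.
- by move=> u; exact: A1m_ge0.
- by move=> u; exact: A1m_ge0.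
- move=> u au; rewrite A1m_nf //; case: ifP => // hu.
  by have := nf_notin _ _ _ chP _ _ _ _ _ hu; rewrite au.
- exact: IH.
- exact: IH.
Qed.

Lemma tclassP u v : tclass rel u = tclass rel v <-> tr_eq rel u v.
Proof.
split=> [|uv]; first by move=> e; have : tclass rel v v := tr_refl rel v; rewrite -e.
apply/seteqP; split=> w /=; rewrite /tclass /= => h; last exact: tr_trans uv h.
exact: tr_trans (tr_sym uv) h.
Qed.

Lemma tlen_tclass w : tlen (tclass rel w) = size w.
Proof.
rewrite /tlen; case: xgetP => [v _ wv|/(_ w)[]]; last exact: tr_refl.
exact/esym/perm_size/(tr_eq_perm _ rel).
Qed.

Lemma maxT_tclass T w :
  maxT rel T (tclass rel w) <-> forall b, maxb rel b w -> b \in T.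
Proof.
split=> h b.
  by move/(maxbP _ _ relC) => [v wv]; apply: h; exists v; exact/tclassP.
by case=> v /tclassP wv; apply: h; apply/(maxbP _ _ relC); exists v.
Qed.

(** Turns sums over traces into sums over words; the three clauses are soundness, uniqueness and
    existence of normal forms. *)
Lemma nf_bij S T :
  set_bij [set w | nf rel ch #|S| S T w] (maxT rel T `&` MS rel S) (tclass rel).
Proof.
split.
- move=> w /= hw; split.
    by apply/maxT_tclass; exact: nf_max relC chP _ _ _ _ hw.
  exists w; split=> //; apply/allP => a; exact: (nf_alphabet _ _ _ chP _ _ _ _ hw).
- move=> u v /set_mem hu /set_mem hv /tclassP.
  exact: (nf_uniq _ _ _ relxx relC chP _ _ _ _ _ hu hv).
- move=> x [xT [w [/allP wS xw]]]; move: xT; rewrite xw => /maxT_tclass wT.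
  have [v hv wv] := nf_exist _ _ _ relC chP _ _ T w erefl wS wT.
  by exists v => //; apply/tclassP; exact: tr_sym.
Qed.

(** On a normal form the weight under [Bsp] is [mu (S :\: T)] times the output probability, and the
    output probabilities sum to [1]. *)
Lemma Bsp_maxT S T : mu_pos S -> Bsp rel S p (maxT rel T) = (mu rel (S :\: T) p)%:E.
Proof.
move=> hS; have mST : 0 < mu rel (S :\: T) p by apply: hS; exact: finset.subsetDl.
rewrite /Bsp (reindex_esum _ _ _ _ (nf_bij S T)).
rewrite -[RHS]mule1 -(A1m_mass #|S| S T erefl hS) -esumZl ?(ltW mST) //; last first.
  by move=> w _; exact: A1m_ge0.
rewrite esum_mkcond; apply: eq_esum => w _; rewrite A1m_nf // tlen_tclass.
case: ifPn => [/set_mem /= ->|/negP]; last first.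
  by rewrite in_setE /= => /negP/negbTE ->; rewrite mule0.
by rewrite -EFinM; congr (_%:E); rewrite mulrA [X in _ = X * _]mulrC divfK // gt_eqF.
Qed.

(** The class of [w] contains at most one normal form, which carries all the output mass of the
    class. *)
Lemma A1_law S T w : mu_pos S ->
  (\esum_(w' in tclass rel w) A1 rel ch p S T w')%E = (Dsp rel S T p (tclass rel w))%:E.
Proof.
move=> hS; rewrite /Dsp Bsp_maxT //= /A1.
have [[v hv wv]|nov] := pselect (exists2 v, nf rel ch #|S| S T v & tr_eq rel w v).
  rewrite (@esum_single _ _ _ _ v) //; last first.
  - move=> u wu uv; rewrite A1m_nf //; case: ifP => // hu; case: uv.
    apply: (nf_uniq _ _ _ relxx relC chP _ _ _ _ _ hu hv).
    exact: tr_trans (tr_sym wu) wv.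
  - exact: A1m_ge0.
  rewrite A1m_nf // hv; congr (_%:E).
  rewrite (perm_size (tr_eq_perm _ _ _ _ (tr_sym wv))).
  have [+ _ _] := nf_bij S T; move=> /(_ v hv) [vT vS].
  rewrite ((tclassP w v).2 wv) /Bsp (@esum_single _ _ _ _ (tclass rel v)) //=.
  - by rewrite tlen_tclass (perm_size (tr_eq_perm _ _ _ _ wv)) mulrAC.
  - by rewrite lee_fin mulr_ge0 ?exprn_ge0 // ltW // hS.
  - by move=> x [[-> _] _].
(* Without a normal form in the class both sides vanish: by surjectivity in [nf_bij], the trace is
   not over [S] or has a maximal letter outside [T]. *)
rewrite esum1 => [|u wu]; last first.
  rewrite A1m_nf //; case: ifP => // hu; case: nov; exists u => //.
rewrite /Bsp esum1 ?mul0r // => x [[-> wT] wS].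
have [_ _ /(_ (tclass rel w) (conj wT wS)) [v hv /tclassP vw]] := nf_bij S T.
by case: nov; exists v => //; exact: tr_sym.
Qed.

End Output.

Theorem theorem2p1 :
  (* correctness: the output of A_1(p,S,T) has law D^p_{S,T} *)
  (forall (R : realType) (Sig : finType) (rel : rel Sig)
     (ch : {set Sig} -> {set Sig} -> option Sig)
     (S T : {set Sig}) (p : R),
     reflexive_symmetric rel -> choice_rule ch -> in_0_pS rel S p ->
     forall w : seq Sig,
       (\esum_(w' in tclass rel w) A1 rel ch p S T w')%E
         = (Dsp rel S T p (tclass rel w))%:E)
  /\
  (* complexity: every execution takes O((|Sigma|+1)(|xi|+1)) steps *)
  (forall c cd : nat, exists C : nat,
     forall (Sig : finType) (rel : rel Sig)
       (ch : {set Sig} -> {set Sig} -> option Sig) (S T : {set Sig})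
       (e : exec),
       reflexive_symmetric rel -> choice_rule ch ->
       valid rel ch cd S T e ->
       (cost rel ch c S T e <= C * (#|Sig| + 1) * (size (out rel ch S T e) + 1))%N).
Proof.
split=> [R Sig rel ch S T p [relxx relC] chP hp w|c cd].
  apply: A1_law => //; first exact: hp.1.
  exact: in_0_pS_mu_gt0 hp.
exists (2 * c + cd)%N => Sig rel ch S T e _ chP /(cost_le _ _ _ chP c) /leq_trans; apply.
by rewrite leq_mul2r leq_mul2l leq_add2r max_card !orbT.
Qed.
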